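(* Let $\alpha$ be an imaginary quadratic integer. Then the set of all irreducible elements of $\mathbb{Z}[\alpha]$ contains $(k,\epsilon,\mathbf{e})$-APs for every $k\ge 3$, $\epsilon>0$, and orthonormal basis $\mathbf{e}$ for $\mathbb{C}$.
   Context: $\mathbb{C}$ is identified with $\mathbb{R}^2$ with its Euclidean norm $\|\cdot\|=|\cdot|$, and an orthonormal basis for $\mathbb{C}$ means an orthonormal basis of $\mathbb{R}^2$. $\mathbb{Z}[\alpha]=\{a+b\alpha : a,b\in\mathbb{Z}\}\subset\mathbb{C}$. Let $\mathbf{e}=\{e_1,\ldots,e_m\}$ be a linearly independent set of vectors in $\mathbb{R}^d$, $1\le m\le d$. For $k\in\mathbb{N}$ and $\Delta>0$, a set $P\subset\mathbb{R}^d$ is an arithmetic patch of size $k$ and scale $\Delta$ with respect to orientation $\mathbf{e}$ if $$P=\Big\{t+\Delta\sum_{i=1}^m x_ie_i : x_i=0,1,\ldots,k-1\Big\}$$ for some $t\in\mathbb{R}^d$. A set $Q\subset\mathbb{R}^d$ is a $(k,\epsilon,\mathbf{e})$-AP if there exists an arithmetic patch $P$ of size $k$ and some scale $\Delta>0$ with respect to orientation $\mathbf{e}$ such that $\#Q=\#P$ and $$\sup_{x\in P}\inf_{y\in Q}\|x-y\|\le\epsilon\Delta.$$ A set $F$ contains $(k,\epsilon,\mathbf{e})$-APs if some subset $Q\subseteq F$ is a $(k,\epsilon,\mathbf{e})$-AP. *)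

(* Defs.v *)
From HB Require Import structures.
From mathcomp Require Import all_boot all_order all_algebra.
From mathcomp Require Import complex.
From mathcomp Require Import mathcomp_extra boolp classical_sets functions.
From mathcomp Require Import cardinality reals.

Set Implicit Arguments.
Unset Strict Implicit.
Unset Printing Implicit Defensive.

Import Order.TTheory GRing.Theory Num.Theory.
Local Open Scope classical_set_scope.
Local Open Scope ring_scope.

Section Euclidean.
Variables (R : realType) (d : nat).
Implicit Types u v : 'rV[R]_d.

Definition dotv u v : R := \sum_(i < d) u 0 i * v 0 i.

(* The norm that the library puts on 'rV[R]_d is the sup norm. *)
Definition enorm u : R := Num.sqrt (dotv u u).

Definition orthonormal_basis (m : nat) (e : m.-tuple 'rV[R]_d) : Prop :=
  basis_of fullv e /\
  forall i j : 'I_m, dotv (tnth e i) (tnth e j) = (i == j)%:R.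

End Euclidean.

(* The notions below are meant for linearly independent families e; this is
   left to the context, and holds in particular for orthonormal bases. *)
Section ArithmeticPatches.
Variables (R : realType) (d m : nat).
Implicit Types (P Q F : set 'rV[R]_d) (e : m.-tuple 'rV[R]_d).

Definition arithmetic_patch (k : nat) (Delta : R) e P : Prop :=
  exists t : 'rV[R]_d,
    P = [set t + Delta *: \sum_(i < m) (x i : nat)%:R *: tnth e i
        | x in [set: 'I_m -> 'I_k]].

(* When k > 0, P is nonempty and finite, hence so is Q, and the real-valued sup
   and inf are a maximum and a minimum. *)
Definition is_AP (k : nat) (eps : R) e Q : Prop :=
  exists P (Delta : R),
    [/\ 0 < Delta,
        arithmetic_patch k Delta e P,
        (Q #= P)%card
      & sup [set inf [set enorm (x - y) | y in Q] | x in P] <= eps * Delta].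

Definition contains_APs (k : nat) (eps : R) e F : Prop :=
  exists Q, Q `<=` F /\ is_AP k eps e Q.

End ArithmeticPatches.

Section Irreducible.
Variable A : nzRingType.
Implicit Types (S : set A) (x y a b : A).

(* Units and irreducible elements of a subring of A, given as a subset S. *)
Definition unit_in S x : Prop := S x /\ exists2 y, S y & x * y = 1.

Definition irreducible_in S x : Prop :=
  [/\ S x, x <> 0, ~ unit_in S x
    & forall a b, S a -> S b -> x = a * b -> unit_in S a \/ unit_in S b].

End Irreducible.

Section QuadraticIntegers.
Variable R : realType.
Implicit Type alpha : R[i].

Definition quadratic_integer alpha : Prop :=
  exists p : {poly int},
    [/\ p \is monic, size p = 3%N & root (map_poly intr p) alpha].

(* A non-real root of p forces p to be irreducible over the rationals, with
   negative discriminant. *)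
Definition imaginary_quadratic_integer alpha : Prop :=
  quadratic_integer alpha /\ alpha \isn't Num.real.

Definition Zadjoin alpha : set R[i] :=
  [set a%:~R + b%:~R * alpha | a in [set: int] & b in [set: int]].

(* The identification of the complex numbers with the Euclidean plane. *)
Definition plane_of_complex (z : R[i]) : 'rV[R]_2 :=
  \row_(j < 2) if j == 0 then complex.Re z else complex.Im z.

End QuadraticIntegers.

(* Main.v *)
Require Import Defs.
From mathcomp Require Import all_boot all_order all_algebra.
From mathcomp Require Import complex.
From mathcomp Require Import classical_sets reals.
From mathcomp Require Import boolp cardinality sequences exp.
From mathcomp Require Import ring lra zify.

Set Implicit Arguments.
Unset Strict Implicit.
Unset Printing Implicit Defensive.

Import Order.TTheory GRing.Theory Num.Theory.
Local Open Scope classical_set_scope.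
Local Open Scope ring_scope.

(** The proof sets two estimates for the irreducible elements of the ring
    S = Z[alpha] against each other; N is the squared modulus, which takes
    natural values on S.

    A set without approximate patches is sparse.  Cut a cube whose axes are
    parallel to e into q ^ d equal cells, where q = k M and M is large compared
    with 1 / eps.  The cells whose indices are all multiples of M are arranged
    like an arithmetic patch of size k, with a scale M times their side; if each
    of them met F, points of F chosen in them would form an approximate patch.
    So at least one cell misses F, and by iteration a cube of side a q ^ n
    contains at most (q ^ d - 1) ^ n points of a set F whose points are far
    enough apart (APfree_count).  Summing over the shells between consecutive
    cubes gives a geometric series, so the sums of |z| ^ - d over finite subsets
    of F are bounded (APfree_summable).

    The irreducible elements are not sparse, by Euler's argument, which rests on
    the existence of factorizations.  Every nonzero nonunit of S is a product
    of irreducibles (irreducible_factorization), so the sum of 1 / N z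
    over finitely many nonunits is at most the product of the geometric series
    of 1 / N p, over finitely many irreducibles p.  If the sums of 1 / N p were
    bounded by B, this product would be at most exp (2 B) (euler_bound).  But
    the lattice S contains enough nonunits to make the sums of 1 / N z
    unbounded, like the harmonic series (nonunit_sum_unbounded).  As
    N z = |z| ^ 2, the case d = 2 of the first estimate shows that the
    irreducible elements contain approximate patches. *)

(** * Coordinates in an orthonormal basis *)

Section Coordinates.
Variables (R : realType) (d : nat) (e : d.-tuple 'rV[R]_d).
Hypothesis e_onb : orthonormal_basis e.
Implicit Types (z w : 'rV[R]_d) (F : set 'rV[R]_d).

Definition coo (i : 'I_d) z : R := dotv (tnth e i) z.

Lemma dotvE z w : dotv z w = (z *m w^T) 0 0.
Proof. by rewrite mxE; apply: eq_bigr => i _; rewrite mxE. Qed.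

Lemma cooD i z w : coo i (z + w) = coo i z + coo i w.
Proof. by rewrite /coo !dotvE linearD mulmxDr mxE. Qed.

Lemma cooZ i a z : coo i (a *: z) = a * coo i z.
Proof. by rewrite /coo !dotvE linearZ -scalemxAr mxE. Qed.

Lemma cooB i z w : coo i (z - w) = coo i z - coo i w.
Proof. by rewrite -scaleN1r cooD cooZ mulN1r. Qed.

Lemma coo_comb (x : 'I_d -> R) i : coo i (\sum_j x j *: tnth e j) = x i.
Proof.
have coo0 : coo i 0 = 0 by rewrite -(scale0r 0) cooZ mul0r.
rewrite (big_morph (coo i) (cooD i) coo0).
rewrite (bigD1 i) //= big1 => [|j ji].
  by rewrite cooZ /coo (e_onb.2 i i) eqxx mulr1 addr0.
by rewrite cooZ /coo (e_onb.2 i j) eq_sym (negPf ji) mulr0.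
Qed.

Lemma parseval z : dotv z z = \sum_i coo i z ^+ 2.
Proof.
pose E : 'M[R]_d := \matrix_i tnth e i.
have EEt : E *m E^T = 1%:M.
  apply/matrixP => i j; rewrite !mxE -(e_onb.2 i j).
  by apply: eq_bigr => l _; rewrite !mxE.
have zE : z *m z^T = (z *m E^T) *m (z *m E^T)^T.
  by rewrite trmx_mul trmxK mulmxA -(mulmxA z) (mulmx1C EEt) mulmx1.
rewrite dotvE zE mxE; apply: eq_bigr => i _; rewrite [_^T _ _]mxE expr2.
suff -> : (z *m E^T) 0 i = coo i z by [].
by rewrite mxE; apply: eq_bigr => l _; rewrite !mxE mulrC.
Qed.

Lemma enorm_ge0 z : 0 <= enorm z. Proof. exact: sqrtr_ge0. Qed.

Lemma coo_le_enorm i z : `|coo i z| <= enorm z.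
Proof.
rewrite -sqrtr_sqr ler_wsqrtr // parseval (bigD1 i) //= lerDl.
by rewrite sumr_ge0 // => j _; exact: sqr_ge0.
Qed.

Lemma enorm_le_coo z (l : R) : 0 <= l -> (forall i, `|coo i z| <= l) ->
  enorm z <= Num.sqrt d%:R * l.
Proof.
move=> l0 zl; rewrite -(ger0_norm l0) -sqrtr_sqr -sqrtrM ?ler0n // ler_wsqrtr //.
rewrite parseval mulr_natl -[d in leRHS]card_ord -sumr_const.
by apply: ler_sum => i _; rewrite -(real_normK (num_real _)) lerXn2r ?nnegrE.
Qed.

(** The half-open cube with lowest corner t, in the coordinates given by e, and
    side l.  Half-open cubes on a grid are disjoint, so that points chosen in
    different cells differ. *)
Definition cell (t : 'I_d -> R) (l : R) z : bool :=
  [forall i, t i <= coo i z < t i + l].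

(** * Sets without approximate patches are sparse *)

(** The lowest corners of these cells form a patch of scale M l, and a point of
    a cell is at distance at most sqrt d * l <= eps * (M l) from its corner. *)
Lemma AP_of_cells (k M : nat) (eps l : R) F (t : 'I_d -> R) :
    (0 < k)%N -> (0 < M)%N -> 0 < l -> Num.sqrt d%:R <= eps * M%:R ->
    (forall x : 'I_d -> 'I_k, exists2 z, F z &
       cell (fun i => t i + (M * x i)%:R * l) l z) ->
  contains_APs k eps e F.
Proof.
move=> k0 M0 l0 dM /(_ _)/cid2-/all_sig2[p Fp cellp].
have {}cellp (x : 'I_d -> 'I_k) i :
    (M * x i)%:R * l <= coo i (p x) - t i < (M * x i)%:R * l + l.
  by have /forallP/(_ i) := cellp x; lra.
pose Delta := M%:R * l; pose t0 := \sum_i t i *: tnth e i.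
pose node (x : 'I_d -> 'I_k) :=
  t0 + Delta *: \sum_(i < d) (x i : nat)%:R *: tnth e i.
have nodeE (x : 'I_d -> 'I_k) i : coo i (node x) = t i + (M * x i)%:R * l.
  by rewrite cooD cooZ !coo_comb natrM /Delta mulrAC.
have node_inj : injective node.
  move=> x y xy; apply: funext => i; apply/val_inj/eqP.
  have := nodeE x i; rewrite xy nodeE => /addrI/(mulIf (lt0r_neq0 l0))/eqP.
  by rewrite eqr_nat eqn_pmul2l // eq_sym.
have p_inj : injective p.
  have p_le (x y : 'I_d -> 'I_k) i : p x = p y -> (x i <= y i)%N.
    move=> xy; have := cellp x i; have := cellp y i; rewrite xy.
    move=> /andP[_ h1] /andP[h2 _]; have := le_lt_trans h2 h1.
    rewrite -[X in _ + X]mul1r -mulrDl ltr_pM2r // natr1 ltr_nat ltnS.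
    by rewrite leq_pmul2l.
  move=> x y xy; apply: funext => i; apply/val_inj/eqP.
  by rewrite eqn_leq !p_le.
exists (range p); split; first by move=> _ [x _ <-].
exists (range node), Delta; split.
- by rewrite mulr_gt0 ?ltr0n.
- by exists t0.
- apply: (@card_eq_trans _ _ _ _ [set: 'I_d -> 'I_k]).
    by apply: inj_card_eq => x y _ _; exact: p_inj.
  by apply: card_esym; apply: inj_card_eq => x y _ _; exact: node_inj.
apply: ge_sup.
  by exists (inf [set enorm (node (fun=> Ordinal k0) - y) | y in range p]),
    (node (fun=> Ordinal k0)) => //; exists (fun=> Ordinal k0).
move=> _ [_ [x _ <-] <-]; apply: (@le_trans _ _ (enorm (node x - p x))).
  apply: ge_inf; last by exists (p x) => //; exists x.
  by exists 0 => _ [y _ <-]; exact: enorm_ge0.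
apply: le_trans (enorm_le_coo (ltW l0) _) _ => [i|].
  by rewrite cooB nodeE distrC ler_norml; have := cellp x i; lra.
by rewrite /Delta mulrA ler_wpM2r // ltW.
Qed.


(** Of the (k M) ^ d cells into which a cube is cut, one misses F, and the
    induction hypothesis bounds the number of points in each of the others.  In a
    cube of side a, there is at most one point of F. *)
Lemma APfree_count (k M : nat) (eps a : R) F :
    (0 < k)%N -> (0 < M)%N -> 0 < a -> Num.sqrt d%:R <= eps * M%:R ->
    (forall z w, F z -> F w -> (forall i, `|coo i (z - w)| < a) -> z = w) ->
    ~ contains_APs k eps e F ->
  forall n t (s : seq 'rV[R]_d), uniq s -> (forall z, z \in s -> F z) ->
    all (cell t (a * ((k * M) ^ n)%:R)) s -> (size s <= ((k * M) ^ d).-1 ^ n)%N.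
Proof.
move=> k0 M0 a0 dM sepF noAP; set q := (k * M)%N.
have q0 : (0 < q)%N by rewrite muln_gt0 k0.
elim=> [|n IHn] t s Us sF /allP sc.
  rewrite !expn0 in sc *; case: s Us sF sc => [|z [|w s]] //=.
  rewrite inE negb_or => /andP[/andP[/eqP zw _] _] sF sc; case: zw.
  have sz : z \in [:: z, w & s] by rewrite inE eqxx.
  have sw : w \in [:: z, w & s] by rewrite !inE eqxx orbT.
  apply: sepF (sF _ sz) (sF _ sw) _ => i; rewrite cooB ltr_norml.
  have /forallP/(_ i) := sc _ sz; have /forallP/(_ i) := sc _ sw.
  by rewrite mulr1; lra.
set l := a * (q ^ n)%:R.
have l0 : 0 < l by rewrite mulr_gt0 // ltr0n expn_gt0 q0.
pose sub (f : {ffun 'I_d -> 'I_q}) i := t i + (f i)%:R * l.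
(* If every cell met F, so would those with all indices multiples of M. *)
have [f0 f0P] : exists f0, forall z, F z -> ~~ cell (sub f0) l z.
  apply: contrapT => noF; apply: noAP.
  apply: (AP_of_cells (t := t) k0 M0 l0 dM) => x.
  have xq i : (M * x i < q)%N by rewrite /q mulnC ltn_pmul2r.
  apply: contrapT => noz; apply: noF; exists [ffun i => Ordinal (xq i)] => z Fz.
  apply/negP => zc; apply: noz; exists z => //; apply/forallP => i.
  by have /forallP/(_ i) := zc; rewrite /sub ffunE.
(* The index of the cell of z is, in each coordinate, the integral part of
   the distance to the corner t divided by l. *)
have cover z : z \in s -> (0 < \sum_(f | f != f0) cell (sub f) l z)%N.
  move=> zs; have /forallP zc := sc _ zs.
  have ex i : exists j : 'I_q, t i + j%:R * l <= coo i z < t i + j%:R * l + l.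
    have /andP[z1 z2] := zc i; set y := (coo i z - t i) / l.
    have y0 : 0 <= y by rewrite divr_ge0 ?subr_ge0 // ltW.
    have yl : coo i z - t i = y * l by rewrite divfK ?gt_eqF.
    have yq : y < q%:R.
      by rewrite ltr_pdivrMr // /l mulrCA -natrM -expnS; lra.
    have /andP[y1 y2] := truncn_itv y0.
    have tq : (Num.truncn y < q)%N by rewrite truncn_lt_nat.
    exists (Ordinal tq) => /=.
    rewrite -(ler_pM2r l0) -yl in y1; rewrite -(ltr_pM2r l0) -yl -natr1 in y2.
    by lra.
  have [f fP] := choice ex.
  have fc : cell (sub (finfun f)) l z.
    by apply/forallP => i; rewrite /sub ffunE.
  rewrite (bigD1 (finfun f)) ?fc //=.
  by apply/eqP => f_f0; move: (f0P z (sF _ zs)); rewrite -f_f0 fc.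
have -> : size s = (\sum_(z <- s) 1)%N by rewrite sum1_size.
apply: (@leq_trans (\sum_(z <- s) \sum_(f | f != f0) cell (sub f) l z)).
  by rewrite big_seq [leqRHS]big_seq; apply: leq_sum => z; exact: cover.
rewrite exchange_big /= expnS.
have cardf : #|[pred f | f != f0]| = (q ^ d).-1.
  have := cardC (pred1 f0); rewrite card1 card_ffun !card_ord => <-.
  by rewrite add1n; apply: eq_card => f; rewrite !inE.
rewrite -[X in (_ <= X * _)%N]cardf -sum_nat_const; apply: leq_sum => f _.
rewrite -(big_mkcond (cell (sub f) l) (fun=> 1%N)) /= sum1_count -size_filter.
apply: (IHn (sub f)); first exact: filter_uniq.
  by move=> z; rewrite mem_filter => /andP[_ /sF].
exact: filter_all.
Qed.

(** With q = k M, the shell between the centered cubes of sides a q ^ (n - 1) and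
    a q ^ n has at most (q ^ d - 1) ^ n points of F, of norm at least
    a q ^ (n - 1) / 2.  It contributes at most a constant times r ^ n to the sum,
    where r = 1 - 1 / q ^ d < 1. *)
Lemma APfree_summable (k : nat) (eps : R) F :
    (1 < k)%N -> 0 < eps ->
    (forall z w, F z -> F w -> z <> w -> 1 <= enorm (z - w)) ->
    (forall z, F z -> 1 <= enorm z) ->
    ~ contains_APs k eps e F ->
  exists B : R, forall s : seq 'rV[R]_d, uniq s -> (forall z, z \in s -> F z) ->
    \sum_(z <- s) (enorm z ^+ d)^-1 <= B.
Proof.
move=> k1 eps0 sepF F1 noAP; have k0 := ltnW k1.
pose M := (Num.truncn (Num.sqrt d%:R / eps)).+1; set q := (k * M)%N.
have dM : Num.sqrt d%:R <= eps * M%:R.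
  by rewrite mulrC -ler_pdivrMr //; apply/ltW/truncnS_gt.
have q1 : (1 < q)%N by rewrite /q (leq_trans k1) // leq_pmulr.
have q0 : 0 < q%:R :> R by rewrite ltr0n ltnW.
(* Points in a common cube of side a are at distance at most
   sqrt d / (d + 1) < 1. *)
pose a : R := d.+1%:R^-1; have a0 : 0 < a by rewrite invr_gt0 ltr0n.
have sepa z w : F z -> F w -> (forall i, `|coo i (z - w)| < a) -> z = w.
  move=> Fz Fw zwa; apply: contrapT => /(sepF _ _ Fz Fw); apply/negP.
  rewrite -ltNge (le_lt_trans (enorm_le_coo (ltW a0) (fun i => ltW (zwa i)))) //.
  rewrite ltr_pdivrMr ?ltr0n // mul1r -[ltRHS]ger0_norm ?ler0n // -sqrtr_sqr.
  rewrite ltr_sqrt ?exprn_gt0 ?ltr0n // -natrX ltr_nat.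
  by rewrite -[X in (X < _)%N]expn1; nia.
have count := APfree_count k0 (ltn0Sn _) a0 dM sepa noAP.
rewrite -/q in count.
pose L n := a * (q ^ n)%:R.
have L0 n : 0 < L n by rewrite mulr_gt0 // ltr0n expn_gt0 ltnW.
pose Q n := cell (fun=> - (L n / 2)) (L n).
pose C := (2 * q%:R / a) ^+ d.
have C1 : 1 <= C.
  rewrite exprn_ege1 // ler_pdivlMr // mul1r (@le_trans _ _ 1) //.
    by rewrite invf_le1 ?ltr0n // ler1n.
  by rewrite -natrM ler1n muln_gt0 (ltnW q1).
pose r : R := ((q ^ d).-1)%:R / (q ^ d)%:R.
have qd0 : 0 < (q ^ d)%:R :> R by rewrite ltr0n expn_gt0 (ltnW q1).
have r1 : 1 - r = (q ^ d)%:R^-1.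
  rewrite -[X in X - _](divff (lt0r_neq0 qd0)) -mulrBl.
  have -> : (q ^ d)%:R = (q ^ d).-1.+1%:R :> R.
    by rewrite prednK // expn_gt0 (ltnW q1).
  by rewrite -natr1 [_ + 1]addrC addrK mul1r.
have r0 : 0 <= r by rewrite divr_ge0.
exists (C * (q ^ d)%:R) => s Us sF.
pose h z := (enorm z ^+ d)^-1.
have h0 z : 0 <= h z by rewrite invr_ge0 exprn_ge0 // enorm_ge0.
(* P selects the points of s in the n-th shell; for n = 0, those in the
   innermost cube. *)
have shell n (P : pred 'rV[R]_d) :
    (forall z, z \in s -> P z -> Q n z /\ h z <= C / (q ^ n)%:R ^+ d) ->
  \sum_(z <- s | P z) h z <= C * r ^+ n.
  move=> PQ; rewrite -big_filter.
  apply: (@le_trans _ _ (\sum_(z <- filter P s) C / (q ^ n)%:R ^+ d)).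
    rewrite big_seq [leRHS]big_seq; apply: ler_sum => z.
    by rewrite mem_filter => /andP[Pz zs]; have [] := PQ _ zs Pz.
  rewrite big_const_seq count_predT iter_addr_0 -[leLHS]mulr_natr.
  rewrite -mulrA ler_pM2l ?(lt_le_trans ltr01) //.
  rewrite /r expr_div_n -!natrX mulrC -!expnM (mulnC n d).
  rewrite ler_wpM2r ?invr_ge0 // ler_nat.
  apply: (count n (fun=> - (L n / 2))); first exact: filter_uniq.
    by move=> z; rewrite mem_filter => /andP[_ /sF].
  by apply/allP => z; rewrite mem_filter => /andP[Pz zs]; have [] := PQ _ zs Pz.
have sumQ n : \sum_(z <- s | Q n z) h z <= C * \sum_(i < n.+1) r ^+ i.
  elim: n => [|n IHn].
    rewrite big_ord1; apply: shell => z zs Qz; split=> //.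
    have z1 : 1 <= enorm z by exact: F1 (sF _ zs).
    rewrite expn0 expr1n divr1 (le_trans _ C1) // invf_le1 ?exprn_ege1 //.
    by rewrite exprn_gt0 // (lt_le_trans ltr01).
  rewrite big_ord_recr /= mulrDr (bigID (Q n)) /= lerD //.
    apply: le_trans IHn; rewrite big_mkcond [leRHS]big_mkcond.
    by apply: ler_sum => z _; case: (Q n z); case: (Q n.+1 z) => //=.
  apply: shell => z zs /andP[Qz nQz]; split=> //.
  have [i zi] : exists i, L n / 2 <= `|coo i z|.
    move: nQz => /forallPn[i zi]; exists i; rewrite leNgt; apply: contra zi.
    by rewrite ltr_norml; move: (L0 n); lra.
  have Lz := le_trans zi (coo_le_enorm i z).
  have -> : C / (q ^ n.+1)%:R ^+ d = ((L n / 2) ^+ d)^-1.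
    rewrite -exprVn -exprMn -exprVn; congr (_ ^+ d).
    rewrite /L expnS natrM; field.
    by rewrite !lt0r_neq0 // ltr0n expn_gt0 (ltnW q1).
  have L20 : 0 < L n / 2 by rewrite divr_gt0.
  rewrite lef_pV2 ?posrE ?exprn_gt0 ?(lt_le_trans L20) //.
  by rewrite lerXn2r ?nnegrE ?enorm_ge0 // ltW.
pose E := \sum_(z <- s) enorm z.
pose n := Num.truncn (2 * E / a).
have sQ z : z \in s -> Q n z.
  move=> zs; have zE : enorm z <= E.
    by rewrite /E (big_rem z) //= lerDl sumr_ge0 // => w _; exact: enorm_ge0.
  have EL : 2 * E < L n.
    rewrite [L n]mulrC -ltr_pdivrMr // (lt_le_trans (truncnS_gt _)) //.
    by rewrite ler_nat ltn_expl.
  have {}EL : E < L n / 2 by rewrite ltr_pdivlMr // mulrC.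
  apply/forallP => i; have := le_lt_trans (le_trans (coo_le_enorm i z) zE) EL.
  by rewrite ltr_norml; lra.
have -> : \sum_(z <- s) (enorm z ^+ d)^-1 = \sum_(z <- s | Q n z) h z.
  rewrite big_seq [RHS]big_seq_cond; apply: eq_bigl => z.
  by case zs: (z \in s) => //=; rewrite sQ.
apply: le_trans (sumQ n) _; rewrite ler_pM2l ?(lt_le_trans ltr01) //.
rewrite -[leRHS]mul1r -ler_pdivrMr // mulrC -r1.
by rewrite -(opprB r 1) mulNr -subrX1 opprB gerBl exprn_ge0.
Qed.

End Coordinates.

(** * Norms and factorizations in an imaginary quadratic ring *)

Section QuadraticRing.
Variable R : realType.
Implicit Types (z w alpha : R[i]).

Definition nrm z : R := complex.Re z ^+ 2 + complex.Im z ^+ 2.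

Lemma nrmM z w : nrm (z * w) = nrm z * nrm w.
Proof. by case: z => a b; case: w => a' b'; rewrite /nrm /=; ring. Qed.

Lemma nrm1 : nrm 1 = 1. Proof. by rewrite /nrm /= expr1n expr0n addr0. Qed.

Lemma nrm_ge0 z : 0 <= nrm z. Proof. by rewrite addr_ge0 ?sqr_ge0. Qed.

Lemma nrm_eq0 z : (nrm z == 0) = (z == 0).
Proof.
by rewrite paddr_eq0 ?sqr_ge0 // !sqrf_eq0 eq_complex.
Qed.

Lemma nrmX z n : nrm (z ^+ n) = nrm z ^+ n.
Proof. by elim: n => [|n IHn]; rewrite ?nrm1 // !exprS nrmM IHn. Qed.

Lemma Re_lin (a b : int) alpha :
  complex.Re (a%:~R + b%:~R * alpha) = a%:~R + b%:~R * complex.Re alpha.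
Proof.
rewrite -[a%:~R in LHS](rmorph_int (real_complex R)).
rewrite -[b%:~R in LHS](rmorph_int (real_complex R)).
by case: alpha => x y /=; ring.
Qed.

Lemma Im_lin (a b : int) alpha :
  complex.Im (a%:~R + b%:~R * alpha) = b%:~R * complex.Im alpha.
Proof.
rewrite -[a%:~R in LHS](rmorph_int (real_complex R)).
rewrite -[b%:~R in LHS](rmorph_int (real_complex R)).
by case: alpha => x y /=; ring.
Qed.

(** If alpha = x + y i is a root of X ^ 2 + p1 X + p0 and y <> 0, the imaginary
    part of the equation reads 2 x = - p1, and then its real part reads
    x ^ 2 + y ^ 2 = p0. *)
Lemma imaginary_quadratic_trace_norm alpha : imaginary_quadratic_integer alpha ->
  complex.Im alpha != 0 /\ exists b c : int,
    2 * complex.Re alpha = b%:~R /\ nrm alpha = c%:~R.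
Proof.
case=> -[p [/monicP p_monic sz_p /eqP p_root]] alpha_nreal.
have y0 : complex.Im alpha != 0.
  by apply: contra alpha_nreal; case: (alpha) => x y /=; rewrite complex_real.
split=> //; have p2 : p`_2 = 1 by rewrite -p_monic lead_coefE sz_p.
move: p_root; rewrite (@horner_coef_wide _ 3) -?sz_p ?size_poly // sz_p.
rewrite !big_ord_recr big_ord0 /= add0r expr0 mulr1 expr1 !coef_map /= p2 mul1r.
move=> /eqP; rewrite eq_complex -[X in _ + X]mul1r => /andP[/eqP].
rewrite -[(p`_0)%:~R](rmorph_int (real_complex R)).
rewrite -[(p`_1)%:~R](rmorph_int (real_complex R)).
move: y0; rewrite /nrm; case: (alpha) => x y /= y0 re /eqP im.
have tr : 2 * x = - (p`_1)%:~R.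
  by apply: (mulIf y0); apply/eqP; rewrite -subr_eq0 -im; apply/eqP; ring.
exists (- p`_1), p`_0; rewrite rmorphN; split=> //; move: re tr.
set c0 := (p`_0)%:~R; set c1 := (p`_1)%:~R => re tr.
have {}tr : c1 = - (2 * x) by rewrite tr opprK.
move: re; rewrite tr => /eqP; rewrite -subr_eq0 => /eqP re.
by apply/eqP; rewrite -subr_eq0 -oppr_eq0 -re; apply/eqP; ring.
Qed.

(** With t the trace and n the norm of alpha, the norm of a + b alpha is
    a ^ 2 + a b t + b ^ 2 n. *)
Lemma Zadjoin_nrm_nat alpha z : imaginary_quadratic_integer alpha ->
  Zadjoin alpha z -> nrm z \is a Num.nat.
Proof.
move=> /imaginary_quadratic_trace_norm[_ [t [n [tE nE]]]] [a _ [b _ <-]].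
rewrite natrEint nrm_ge0 andbT.
have -> : nrm (a%:~R + b%:~R * alpha) = (a * a + a * b * t + b * b * n)%:~R.
  by rewrite !rmorphD !rmorphM /= -tE -nE /nrm Re_lin Im_lin; ring.
exact: intr_int.
Qed.

Lemma ZadjoinB alpha z w : Zadjoin alpha z -> Zadjoin alpha w ->
  Zadjoin alpha (z - w).
Proof.
move=> [a _ [b _ <-]] [a' _ [b' _ <-]]; exists (a - a') => //.
exists (b - b') => //.
by rewrite !rmorphB /=; ring.
Qed.

(** An element of norm 1 is inverted by its conjugate, which lies in the ring
    because the conjugate of alpha is its trace minus alpha. *)
Lemma Zadjoin_unit alpha z : imaginary_quadratic_integer alpha ->
  Zadjoin alpha z -> unit_in (Zadjoin alpha) z <-> nrm z = 1.
Proof.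
move=> iqi Zz; split=> [[_ [w Zw zw1]]|z1].
  have /natrP[m mE] := Zadjoin_nrm_nat iqi Zz.
  have /natrP[n nE] := Zadjoin_nrm_nat iqi Zw.
  have := nrmM z w; rewrite zw1 nrm1 mE nE -natrM => /esym/eqP.
  by rewrite (eqr_nat _ _ 1%N) muln_eq1 => /andP[/eqP -> _].
split=> //; have [_ [t [_ [tE _]]]] := imaginary_quadratic_trace_norm iqi.
case: Zz z1 => a _ [b _ zE] z1.
pose w := (a + b * t)%:~R + (- b)%:~R * alpha.
exists w; first by exists (a + b * t) => //; exists (- b).
have wRe : complex.Re w = complex.Re z.
  by rewrite -zE !Re_lin !rmorphD !rmorphN !rmorphM /= -tE; ring.
have wIm : complex.Im w = - complex.Im z.
  by rewrite -zE !Im_lin rmorphN /= mulNr.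
apply/eqP; rewrite eq_complex; move: z1 wRe wIm; rewrite /nrm.
clearbody w; case: (z) => x y; case: w => x' y' /= z1 -> ->.
by apply/andP; split; apply/eqP; [rewrite -z1|]; ring.
Qed.

Lemma Zadjoin_nonunit alpha z : imaginary_quadratic_integer alpha ->
  Zadjoin alpha z -> z != 0 -> ~ unit_in (Zadjoin alpha) z -> 2 <= nrm z.
Proof.
move=> iqi Zz z0 /(Zadjoin_unit iqi Zz).
have /natrP[n] := Zadjoin_nrm_nat iqi Zz; move: z0; rewrite -nrm_eq0 => + nE.
rewrite nE pnatr_eq0 (ler_nat _ 2); by case: n {nE} => [|[|n]].
Qed.

(** Induction on the norm: if z is a product of two nonunits, both have norm at
    least 2, hence a norm less than that of z. *)
Lemma irreducible_factorization alpha z : imaginary_quadratic_integer alpha ->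
    Zadjoin alpha z -> z != 0 -> ~ unit_in (Zadjoin alpha) z ->
  exists s : seq R[i], (forall x, x \in s -> irreducible_in (Zadjoin alpha) x)
    /\ z = \prod_(x <- s) x.
Proof.
move=> iqi; have [n] := ubnP (Num.truncn (nrm z)).
elim: n z => // n IHn z; rewrite ltnS => zn Zz z0 zU.
apply: contrapT => noz; suff zI : irreducible_in (Zadjoin alpha) z.
  apply: noz; exists [:: z]; rewrite big_seq1; split=> // x.
  by rewrite inE => /eqP ->.
split=> // [|a b Za Zb zab]; first exact/eqP.
apply: contrapT => /not_orP[aU bU]; apply: noz.
have [a0 b0] : a != 0 /\ b != 0.
  by apply/andP; rewrite -negb_or -mulf_eq0 -zab.
have a2 := Zadjoin_nonunit iqi Za a0 aU; have b2 := Zadjoin_nonunit iqi Zb b0 bU.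
have [an bn] : (Num.truncn (nrm a) < n)%N /\ (Num.truncn (nrm b) < n)%N.
  move: zn a2 b2; rewrite zab nrmM.
  have /natrP[i ->] := Zadjoin_nrm_nat iqi Za.
  have /natrP[j ->] := Zadjoin_nrm_nat iqi Zb.
  by rewrite -natrM !natrK !(ler_nat _ 2); nia.
have [s [sI aE]] := IHn a an Za a0 aU; have [s' [sI' bE]] := IHn b bn Zb b0 bU.
exists (s ++ s'); split; last by rewrite big_cat /= -aE -bE.
by move=> x; rewrite mem_cat => /orP[/sI|/sI'].
Qed.

(** * Divergence over the irreducible elements *)

Lemma ler_sum_subset (I : eqType) (s t : seq I) (h : I -> R) :
  uniq s -> {subset s <= t} -> (forall i, 0 <= h i) ->
  \sum_(i <- s) h i <= \sum_(i <- t) h i.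
Proof.
move=> + + h0; elim: s t => [|x s IHs] t /=.
  by move=> _ _; rewrite big_nil sumr_ge0.
move=> /andP[xs Us] st; have xt : x \in t by rewrite st // inE eqxx.
rewrite big_cons (big_rem x xt) /= lerD2l; apply: IHs => // y ys.
apply: rem_mem; first by apply: contraNneq xs => <-.
by rewrite st // inE ys orbT.
Qed.

(** The terms of the expanded product of the finite geometric series
    1 + p + ... + p ^ (J - 1), for p in P; an element occurs once for each of its
    factorizations. *)
Fixpoint monomials (J : nat) (P : seq R[i]) : seq R[i] :=
  if P is p :: P' then [seq p ^+ j * w | j <- iota 0 J, w <- monomials J P']
  else [:: 1].

Lemma mem_monomials J (P s : seq R[i]) : (size s < J)%N -> {subset s <= P} ->
  \prod_(x <- s) x \in monomials J P.
Proof.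
elim: P s => [|p P IHP] s sJ sP /=.
  case: s sJ sP => [|x s] _ sP; first by rewrite big_nil inE.
  by have := sP x; rewrite inE eqxx => /(_ isT).
rewrite (bigID (pred1 p)) /= (eq_bigr (fun=> p)) => [|x /eqP //].
rewrite big_const_seq iter_mulr_1; apply: allpairs_f.
  by rewrite mem_iota (leq_ltn_trans (count_size _ _)).
rewrite -big_filter; apply: IHP.
  by rewrite size_filter (leq_ltn_trans (count_size _ _)).
move=> x; rewrite mem_filter => /andP[xp /sP].
by rewrite inE (negPf xp).
Qed.

Lemma geometric_le (x : R) J : 0 <= x -> x <= 2^-1 ->
  \sum_(j <- iota 0 J) x ^+ j <= 1 + 2 * x.
Proof.
move=> x0 x2; have x1 : 0 < 1 - x by lra.
have := subrX1 x J; rewrite -(big_mkord xpredT (fun j => x ^+ j)).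
rewrite /index_iota subn0; have := exprn_ge0 J x0.
set S := \sum_(_ <- _) _ => xJ SE; rewrite -(ler_pM2l x1).
have xx : 0 <= x * (1 - 2 * x) by rewrite mulr_ge0 //; lra.
by have -> : (1 - x) * S = 1 - x ^+ J; [rewrite -[RHS]opprB SE; ring | nra].
Qed.

(** 1 / N is multiplicative, so the sum factors into geometric series, each of
    ratio 1 / N p <= 1 / 2. *)
Lemma sum_monomials_le J (P : seq R[i]) : (forall p, p \in P -> 2 <= nrm p) ->
  \sum_(z <- monomials J P) (nrm z)^-1 <= \prod_(p <- P) (1 + 2 * (nrm p)^-1).
Proof.
elim: P => [|p P IHP] P2 /=; first by rewrite big_seq1 big_nil nrm1 invr1.
have p2 : 2 <= nrm p by rewrite P2 // inE eqxx.
rewrite big_allpairs_dep big_cons.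
under eq_bigr do under eq_bigr do rewrite nrmM invfM.
under eq_bigr do rewrite -mulr_sumr.
rewrite -mulr_suml ler_pM //.
- by rewrite sumr_ge0 // => j _; rewrite invr_ge0 nrm_ge0.
- by rewrite sumr_ge0 // => j _; rewrite invr_ge0 nrm_ge0.
- rewrite (eq_bigr (fun j => (nrm p)^-1 ^+ j)) => [|j _].
    apply: geometric_le; first by rewrite invr_ge0 nrm_ge0.
    by rewrite lef_pV2 ?posrE // (lt_le_trans _ p2).
  by rewrite exprVn nrmX.
- by apply: IHP => x xP; rewrite P2 // inE xP orbT.
Qed.

(** Each z of T is a product of irreducibles.  Let P list those that occur in
    chosen factorizations of the elements of T; then the elements of T are among
    the monomials in P, and 1 + x <= exp x bounds the product over P. *)
Lemma euler_bound alpha (B : R) : imaginary_quadratic_integer alpha ->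
    (forall P : seq R[i], uniq P ->
       (forall p, p \in P -> irreducible_in (Zadjoin alpha) p) ->
       \sum_(p <- P) (nrm p)^-1 <= B) ->
  forall T : seq R[i], uniq T -> (forall z, z \in T ->
      [/\ Zadjoin alpha z, z != 0 & ~ unit_in (Zadjoin alpha) z]) ->
    \sum_(z <- T) (nrm z)^-1 <= expR (2 * B).
Proof.
move=> iqi irrB T UT TS.
have /choice[f fP] (z : R[i]) : exists s : seq R[i], z \in T ->
    (forall x, x \in s -> irreducible_in (Zadjoin alpha) x)
    /\ z = \prod_(x <- s) x.
  case zT: (z \in T); last by exists [::].
  have [Zz z0 zU] := TS z zT.
  by have [s sP] := irreducible_factorization iqi Zz z0 zU; exists s.
pose fs := flatten [seq f z | z <- T]; pose P := undup fs.
have PI p : p \in P -> irreducible_in (Zadjoin alpha) p.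
  by rewrite mem_undup => /flatten_mapP[z zT pz]; apply: (fP z zT).1.
have P2 p : p \in P -> 2 <= nrm p.
  by move=> /PI[Zp /eqP p0 pU _]; exact: Zadjoin_nonunit Zp p0 pU.
have nrmV0 z : 0 <= (nrm z)^-1 by rewrite invr_ge0 nrm_ge0.
apply: (@le_trans _ _ (\sum_(z <- monomials (size fs).+1 P) (nrm z)^-1)).
  apply: ler_sum_subset => // z zT; rewrite (fP z zT).2; apply: mem_monomials.
    rewrite ltnS /fs; elim: (T) zT => //= x T' IHT; rewrite inE size_cat.
    move=> /orP[/eqP -> |/IHT]; [exact: leq_addr|].
    by move/leq_trans; apply; exact: leq_addl.
  by move=> x xz; rewrite mem_undup; apply/flatten_mapP; exists z.
apply: le_trans (sum_monomials_le _ P2) _.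
apply: (@le_trans _ _ (\prod_(p <- P) expR (2 * (nrm p)^-1))).
  by apply: ler_prod => p _; rewrite expR_ge1Dx andbT addr_ge0 // mulr_ge0.
rewrite -expR_sum -mulr_sumr ler_expR ler_pM2l //.
by apply: irrB; [exact: undup_uniq|].
Qed.

(** Each block 2 ^ m <= a < 2 ^ (m + 1) contributes at least 1 / 2. *)
Lemma harmonic_unbounded (B : R) : exists n, B < \sum_(2 <= a < n) a%:R^-1.
Proof.
have H m : m%:R / 2 <= \sum_(2 <= a < 2 ^ m.+1) a%:R^-1 :> R.
  elim: m => [|m IHm]; first by rewrite mul0r big_geq.
  have m2 : (2 <= 2 ^ m.+1)%N by rewrite -[X in (X <= _)%N]expn1 leq_exp2l.
  have mm : (2 ^ m.+1 <= 2 ^ m.+2)%N by rewrite leq_exp2l.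
  rewrite (big_cat_nat m2 mm) /= -natr1 mulrDl lerD //.
  apply: (@le_trans _ _ (\sum_(2 ^ m.+1 <= a < 2 ^ m.+2) (2 ^ m.+2)%:R^-1)).
    have -> : (2 ^ m.+2 = 2 ^ m.+1 + 2 ^ m.+1)%N by rewrite addnn -mul2n -expnS.
    rewrite sumr_const_nat addnK -mulr_natl natrD -mulr2n -mulr_natl.
    set x := (2 ^ _)%:R; have x0 : x != 0 by rewrite pnatr_eq0 expn_eq0.
    by rewrite le_eqVlt; apply/orP; left; apply/eqP; field.
  apply: ler_sum_nat => a /andP[a1 a2].
  have a0 : (0 < a)%N by rewrite (leq_trans _ a1) // expn_gt0.
  by rewrite lef_pV2 ?posrE ?ltr0n ?expn_gt0 // ler_nat ltnW.
exists (2 ^ (Num.truncn (2 * B)).+2)%N; apply: lt_le_trans (H _).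
by rewrite ltr_pdivlMr // mulrC truncnS_gt.
Qed.

(** The elements a + sg b alpha with 0 <= b < a have norm at most C a ^ 2, so
    that the a of them with given a contribute at least 1 / (C a). *)
Lemma nonunit_sum_unbounded alpha (B : R) : imaginary_quadratic_integer alpha ->
  exists T : seq R[i], [/\ uniq T, forall z, z \in T ->
      [/\ Zadjoin alpha z, z != 0 & ~ unit_in (Zadjoin alpha) z]
    & B < \sum_(z <- T) (nrm z)^-1].
Proof.
move=> iqi; have [y0 _] := imaginary_quadratic_trace_norm iqi.
set x := complex.Re alpha; set y := complex.Im alpha in y0 *.
(* The sign makes sg b alpha have nonnegative real part, so the norm is at
   least a ^ 2 > 1 and the elements are nonunits. *)
pose sg : int := if 0 <= x then 1 else -1.
have sgE : sg%:~R * x = `|x| :> R.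
  rewrite /sg; case: ifP => [x0|]; first by rewrite mul1r ger0_norm.
  by move/negbT; rewrite -ltNge => x0; rewrite mulN1r ltr0_norm.
have sg2 : sg%:~R ^+ 2 = 1 :> R.
  by rewrite /sg; case: ifP; rewrite ?sqrrN expr1n.
pose el (a b : nat) : R[i] := (a : int)%:~R + (sg * (b : int))%:~R * alpha.
have elE a b : nrm (el a b) = (a%:R + b%:R * `|x|) ^+ 2 + (b%:R * y) ^+ 2.
  rewrite /nrm Re_lin Im_lin rmorphM /= -sgE -/x -/y.
  rewrite -[in LHS](mulrA _ _ y) [in LHS]exprMn sg2 mul1r.
  by congr (_ + _); ring.
pose C := (1 + `|x|) ^+ 2 + y ^+ 2.
have C0 : 0 < C by rewrite ltr_wpDr ?sqr_ge0 // exprn_gt0 // ltr_pwDl.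
have el_le a b : (b <= a)%N -> nrm (el a b) <= C * a%:R ^+ 2.
  move=> ba; rewrite elE /C mulrDl -!exprMn.
  have b0 : 0 <= b%:R :> R by [].
  have {}ba : b%:R <= a%:R :> R by rewrite ler_nat.
  rewrite lerD // ?exprMn; last first.
    by rewrite [leRHS]mulrC ler_wpM2r ?sqr_ge0 // lerXn2r ?nnegrE.
  rewrite -exprMn lerXn2r ?nnegrE ?addr_ge0 ?mulr_ge0 ?addr_ge0 //.
  by rewrite mulrDl mul1r lerD2l mulrC ler_wpM2l.
have el_ge a b : (2 <= a)%N -> 4 <= nrm (el a b).
  move=> a2; rewrite elE; have {}a2 : 2 <= a%:R :> R by rewrite ler_nat.
  apply: (@le_trans _ _ ((a%:R + b%:R * `|x|) ^+ 2)).
    2: by rewrite lerDl sqr_ge0.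
  have : 0 <= b%:R * `|x| by rewrite mulr_ge0.
  by nra.
have [n nB] := harmonic_unbounded (C * B).
exists [seq el a b | a <- index_iota 2 n, b <- iota 0 a]; split.
- apply: allpairs_uniq_dep => [|a _|]; try exact: iota_uniq.
  move=> /= [a b] [a' b'] _ _ /= ab.
  have bb : b = b'.
    have := congr1 (@complex.Im R) ab; rewrite !Im_lin => /(mulIf y0)/intr_inj.
    rewrite /sg; case: ifP => _; first by rewrite !mul1r; case.
    by rewrite !mulN1r => /oppr_inj; case.
  have aa : a = a'.
    have := congr1 (@complex.Re R) ab; rewrite !Re_lin bb => /addIr/intr_inj.
    by case.
  by rewrite aa bb.
- move=> z /allpairsPdep[a [b [+ _ ->]]]; rewrite mem_index_iota => /andP[a2 _].
  have Zz : Zadjoin alpha (el a b).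
    by exists (a : int) => //; exists (sg * (b : int)).
  have z4 := el_ge a b a2; split=> //.
    by rewrite -nrm_eq0 gt_eqF // (lt_le_trans _ z4).
  by move=> /(Zadjoin_unit iqi Zz) z1; move: z4; rewrite z1; lra.
rewrite big_allpairs_dep /=; rewrite -(ltr_pM2l C0); apply: lt_le_trans nB _.
rewrite mulr_sumr; apply: ler_sum_nat => a /andP[a2 _].
have a0 : 0 < a%:R :> R by rewrite ltr0n (leq_trans _ a2).
apply: (@le_trans _ _ (C * \sum_(b <- iota 0 a) (C * a%:R ^+ 2)^-1)).
  rewrite big_const_seq count_predT size_iota iter_addr_0.
  rewrite -[X in C * X]mulr_natl.
  by rewrite le_eqVlt; apply/orP; left; apply/eqP; field; rewrite !lt0r_neq0.
rewrite ler_pM2l // big_seq [leRHS]big_seq; apply: ler_sum => b.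
rewrite mem_iota add0n => ba; have z4 := el_ge a b a2.
rewrite lef_pV2 ?posrE ?el_le 1?ltnW // ?mulr_gt0 ?exprn_gt0 //.
by rewrite (lt_le_trans _ z4).
Qed.

End QuadraticRing.

(** * Approximate patches of irreducible elements *)

Section ComplexPlane.
Variable R : realType.
Implicit Types z w : R[i].

Lemma plane_of_complexB z w :
  plane_of_complex z - plane_of_complex w = plane_of_complex (z - w).
Proof.
by case: z w => [x y] [x' y']; apply/rowP => j; rewrite !mxE /=; case: ifP.
Qed.

Lemma plane_of_complex_inj : injective (@plane_of_complex R).
Proof.
move=> z w /rowP zw; apply/eqP; rewrite eq_complex.
by have := zw 0; have := zw 1; rewrite !mxE /= => -> ->; rewrite !eqxx.
Qed.

Lemma enorm_plane z : enorm (plane_of_complex z) = Num.sqrt (nrm z).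
Proof.
by rewrite /enorm /dotv big_ord_recl big_ord1 !mxE /= /nrm !expr2.
Qed.

End ComplexPlane.

Theorem mainTheorem6 (R : realType) (alpha : R[i])
    (alpha_iqi : imaginary_quadratic_integer alpha)
    (k : nat) (k_ge3 : (3 <= k)%N) (eps : R) (eps_gt0 : 0 < eps)
    (e : 2.-tuple 'rV[R]_2) (e_onb : orthonormal_basis e) :
  contains_APs k eps e
    (@plane_of_complex R @` [set z | irreducible_in (Zadjoin alpha) z]).
Proof.
apply: contrapT => noAP.
have enorm1 z : Zadjoin alpha z -> z != 0 -> 1 <= enorm (plane_of_complex z).
  move=> Zz; rewrite -nrm_eq0 enorm_plane -[X in X <= _]sqrtr1 => z0.
  rewrite ler_wsqrtr //; move: z0.
  have /natrP[n ->] := Zadjoin_nrm_nat alpha_iqi Zz.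
  by rewrite pnatr_eq0 -lt0n ler1n.
have [] := APfree_summable e_onb (ltnW k_ge3) eps_gt0 _ _ noAP.
- move=> _ _ [z [Zz _ _ _] <-] [w [Zw _ _ _] <-] zw.
  rewrite plane_of_complexB; apply: enorm1; first exact: ZadjoinB.
  by rewrite subr_eq0; apply/eqP => zw'; rewrite zw' in zw.
- by move=> _ [z [Zz /eqP z0 _ _] <-]; exact: enorm1.
move=> B HB; have [T [UT TS]] := nonunit_sum_unbounded (expR (2 * B)) alpha_iqi.
apply/negP; rewrite -leNgt; apply: (euler_bound alpha_iqi _ UT TS) => P UP PI.
have := HB [seq plane_of_complex p | p <- P].
rewrite map_inj_uniq; last exact: plane_of_complex_inj.
rewrite big_map; under eq_bigr do rewrite enorm_plane sqr_sqrtr ?nrm_ge0 //.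
by apply=> // _ /mapP[p /PI pI ->]; exists p.
Qed.
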